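(* Let $F$ be any field, let $F(x)$ be the field of rational functions in $x$ over $F$, and let $G$ be any finite subgroup of $PGL(2,F)$. Let $\Phi(x)=f(x)/g(x)$, with $f,g\in F[x]$ relatively prime, be a generator of the field $F(x)^G$. Let $z$ be an indeterminate over $F$. Then the polynomial $f(T)-zg(T)$ in $F(z)[T]$ is irreducible over $F(z)$ and has Galois group $G$. Its splitting field over $F(z)$ is a rational function field in one variable over $F$ and is thus a regular extension of $F$.
   Context: $PGL(2,F)$ acts as the group of $F$-automorphisms of $F(x)$: the element represented by $s(x)=\frac{ax+b}{cx+d}$ ($ad-bc\ne 0$) sends $r(x)$ to $r(s(x))$. $F(x)^G$ is the subfield of elements fixed by all of $G$; a generator of $F(x)^G$ is an element $\Phi(x)$ with $F(x)^G=F(\Phi(x))$. *)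

(* Defs.v *)
From HB Require Import structures.
From mathcomp Require Import all_boot all_order all_algebra.
From mathcomp Require Import all_fingroup all_solvable all_field.
From mathcomp Require Import finmap generic_quotient.

Set Implicit Arguments.
Unset Strict Implicit.
Unset Printing Implicit Defensive.

Import GRing.Theory.
Local Open Scope ring_scope.
Local Open Scope quotient_scope.

(* PGL(2, F), for an arbitrary (possibly infinite) field F, is the quotient of
   GL(2, F) by the nonzero scalar matrices. *)
Section PGL2.
Variable F : fieldType.

Definition GL2 : Type := {A : 'M[F]_2 | A \in unitmx}.
HB.instance Definition _ := SubChoice.on GL2.

Definition pgl_eqv (A B : GL2) : bool := is_scalar_mx (val A *m invmx (val B)).

Lemma pgl_eqvP (A B : GL2) :
  reflect (exists2 c, c != 0 & val A = c *: val B) (pgl_eqv A B).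
Proof.
apply: (iffP is_scalar_mxP) => [[c eqAB]|[c c0 ->]]; last first.
  by exists c; rewrite -scalemxAl mulmxV ?(valP B) // scalemx1.
have eA : val A = c *: val B.
  by rewrite -[LHS](mulmxKV (valP B)) eqAB mul_scalar_mx.
exists c => //; apply: contraTneq (valP A) => c0.
by rewrite eA c0 scale0r unitmxE det0 unitr0.
Qed.

Lemma pgl_eqv_refl : reflexive pgl_eqv.
Proof. by move=> A; apply/pgl_eqvP; exists 1; rewrite ?oner_eq0 ?scale1r. Qed.

Lemma pgl_eqv_sym : symmetric pgl_eqv.
Proof.
suff sub A B : pgl_eqv A B -> pgl_eqv B A by move=> A B; apply/idP/idP; apply: sub.
move=> /pgl_eqvP[c c0 eA]; apply/pgl_eqvP; exists c^-1; first by rewrite invr_eq0.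
by rewrite eA scalerA mulVf // scale1r.
Qed.

Lemma pgl_eqv_trans : transitive pgl_eqv.
Proof.
move=> B A C /pgl_eqvP[c c0 eA] /pgl_eqvP[d d0 eB]; apply/pgl_eqvP.
by exists (c * d); rewrite ?eA ?eB ?mulf_neq0 ?scalerA.
Qed.

Canonical pgl_equiv := EquivRel pgl_eqv pgl_eqv_refl pgl_eqv_sym pgl_eqv_trans.

Definition PGL2 : Type := {eq_quot pgl_eqv}.
HB.instance Definition _ : EqQuotient _ pgl_eqv PGL2 := EqQuotient.on PGL2.
HB.instance Definition _ := Choice.on PGL2.

Fact GL2_mul_subproof (A B : GL2) : val A *m val B \in unitmx.
Proof. by rewrite unitmx_mul (valP A) (valP B). Qed.

Fact GL2_inv_subproof (A : GL2) : invmx (val A) \in unitmx.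
Proof. by rewrite unitmx_inv (valP A). Qed.

Definition GL2_one : GL2 := Sub 1%:M (unitmx1 F 2).
Definition GL2_mul (A B : GL2) : GL2 := Sub (val A *m val B) (GL2_mul_subproof A B).
Definition GL2_inv (A : GL2) : GL2 := Sub (invmx (val A)) (GL2_inv_subproof A).

Definition PGL2_one : PGL2 := lift_cst PGL2 GL2_one.
Definition PGL2_mul := lift_op2 PGL2 GL2_mul.
Definition PGL2_inv := lift_op1 PGL2 GL2_inv.

Canonical PGL2_one_pi := PiConst PGL2_one.

Lemma PGL2_mul_pi : {morph \pi_PGL2 : A B / GL2_mul A B >-> PGL2_mul A B}.
Proof.
move=> A B; unlock PGL2_mul; apply/eqmodP/pgl_eqvP => /=.
have /eqmodP/pgl_eqvP[c c0 ->] : repr (\pi_PGL2 A) = A %[mod PGL2] by rewrite reprK.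
have /eqmodP/pgl_eqvP[d d0 ->] : repr (\pi_PGL2 B) = B %[mod PGL2] by rewrite reprK.
exists (c * d)^-1; first by rewrite invr_eq0 mulf_neq0.
by rewrite -scalemxAl -scalemxAr !scalerA -mulrA mulVf ?mulf_neq0 // scale1r.
Qed.
Canonical PGL2_mul_pi_morph := PiMorph2 PGL2_mul_pi.

Lemma PGL2_inv_pi : {morph \pi_PGL2 : A / GL2_inv A >-> PGL2_inv A}.
Proof.
move=> A; unlock PGL2_inv; apply/eqmodP/pgl_eqvP => /=.
have /eqmodP/pgl_eqvP[c c0 ->] : repr (\pi_PGL2 A) = A %[mod PGL2] by rewrite reprK.
exists c => //; rewrite invmxZ; first by rewrite scalerA mulfV // scale1r.
by rewrite unitmxZ ?unitfE //; exact: (valP A).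
Qed.
Canonical PGL2_inv_pi_morph := PiMorph1 PGL2_inv_pi.

Lemma PGL2_mulA : associative PGL2_mul.
Proof.
elim/quotW=> A; elim/quotW=> B; elim/quotW=> C; rewrite !piE.
by congr (\pi); apply: val_inj; rewrite /= mulmxA.
Qed.

Lemma PGL2_mul1 : left_id PGL2_one PGL2_mul.
Proof.
elim/quotW=> A; rewrite !piE.
by congr (\pi); apply: val_inj; rewrite /= mul1mx.
Qed.

Lemma PGL2_1mul : right_id PGL2_one PGL2_mul.
Proof.
elim/quotW=> A; rewrite !piE.
by congr (\pi); apply: val_inj; rewrite /= mulmx1.
Qed.

Lemma PGL2_mulV : left_inverse PGL2_one PGL2_inv PGL2_mul.
Proof.
elim/quotW=> A; rewrite !piE.
by congr (\pi); apply: val_inj; rewrite /= mulVmx ?(valP A).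
Qed.

Lemma PGL2_Vmul : right_inverse PGL2_one PGL2_inv PGL2_mul.
Proof.
elim/quotW=> A; rewrite !piE.
by congr (\pi); apply: val_inj; rewrite /= mulmxV ?(valP A).
Qed.

HB.instance Definition _ := isGroup.Build PGL2
  PGL2_mulA PGL2_mul1 PGL2_1mul PGL2_mulV PGL2_Vmul.

End PGL2.

Notation ratfun F := {fraction {poly F}}.
Notation "p %:F" := (FracField.tofrac p) : ring_scope.

Definition ratfunC (F : fieldType) : F -> ratfun F := @FracField.tofrac _ \o polyC.
HB.instance Definition _ (F : fieldType) := GRing.RMorphism.on (@ratfunC F).

(* u lies in F(t), the subfield of E generated over F by t; iota : F -> E is
   the structure map of the extension. *)
Definition in_adjoin (F E : fieldType) (iota : {rmorphism F -> E}) (t u : E) :=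
  exists p q : {poly F},
    (map_poly iota q).[t] != 0 /\ u = (map_poly iota p).[t] / (map_poly iota q).[t].

(* The substitution r(x) |-> r(s(x)).  It is meaningful only for s transcendental
   over F, i.e. nonconstant, in which case the denominator below is nonzero and
   the value is p(s)/q(s) for any expression r = p/q: see ratfun_compE. *)
Definition ratfun_comp (F : fieldType) (r s : ratfun F) : ratfun F :=
  (map_poly (@ratfunC F) \n_(repr r)).[s] / (map_poly (@ratfunC F) \d_(repr r)).[s].

Lemma ratfun_numden (F : fieldType) (r : ratfun F) :
  r = (\n_(repr r))%:F / (\d_(repr r))%:F.
Proof.
have dF0 : (\d_(repr r))%:F != 0 :> ratfun F by rewrite tofrac_eq0 denom_ratioP.
apply: (mulIf dF0); rewrite divfK // -{1}[r]reprK; unlock FracField.tofrac.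
rewrite -[LHS]FracField.pi_mul; apply/eqmodP.
by rewrite /= FracField.equivfE /FracField.mulf /= !numden_Ratio ?mulr1 ?oner_neq0
  ?denom_ratioP // mulrC.
Qed.

Lemma ratfun_compE (F : fieldType) (p q : {poly F}) (s : ratfun F) :
  ~ algebraicOver (@ratfunC F) s -> q != 0 ->
  ratfun_comp (p%:F / q%:F) s =
    (map_poly (@ratfunC F) p).[s] / (map_poly (@ratfunC F) q).[s].
Proof.
move=> s_tr q0; set r := p%:F / q%:F.
have ev0 v : v != 0 -> (map_poly (@ratfunC F) v).[s] != 0.
  by move=> v0; apply/negP => /eqP/rootP sv; apply: s_tr; exists v.
have d0 : \d_(repr r) != 0 by exact: denom_ratioP.
apply/eqP; rewrite /ratfun_comp eqr_div ?ev0 // -!hornerM -!rmorphM /=.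
suff -> : \n_(repr r) * q = p * \d_(repr r) by [].
apply/eqP; rewrite -tofrac_eq !tofracM -eqr_div ?tofrac_eq0 //.
by rewrite -ratfun_numden.
Qed.

Definition mobius (F : fieldType) (A : 'M[F]_2) : ratfun F :=
  ((A ord0 ord0)%:P * 'X + (A ord0 ord_max)%:P)%:F
    / ((A ord_max ord0)%:P * 'X + (A ord_max ord_max)%:P)%:F.

Definition PGL2_mobius (F : fieldType) (s : PGL2 F) : ratfun F :=
  mobius (val (repr s)).

Lemma PGL2_mobius_pi (F : fieldType) (A : GL2 F) :
  PGL2_mobius (\pi_(PGL2 F) A) = mobius (val A).
Proof.
have /eqmodP/pgl_eqvP[c c0 eA] : repr (\pi_(PGL2 F) A) = A %[mod PGL2 F].
  by rewrite reprK.
rewrite /PGL2_mobius eA /mobius !mxE !polyCM -!mulrA -!mulrDr !tofracM.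
have cF0 : c%:P%:F != 0 :> ratfun F by rewrite tofrac_eq0 polyC_eq0.
by rewrite -mulf_div divff // mul1r.
Qed.

(* (r . s)(x) = r(s(x)): composition turns the product of PGL(2, F) around, so
   this is a right action; the fixed field is the same for either side. *)
Definition PGL2_act (F : fieldType) (s : PGL2 F) (r : ratfun F) : ratfun F :=
  ratfun_comp r (PGL2_mobius s).

Definition fixed_ratfun (F : fieldType) (G : {fset PGL2 F}) (r : ratfun F) : Prop :=
  forall s, s \in G -> PGL2_act s r = r.

Definition generates_fixed_field (F : fieldType) (G : {fset PGL2 F})
    (Phi : ratfun F) : Prop :=
  forall r, fixed_ratfun G r <-> in_adjoin (@ratfunC F) Phi r.

Definition group_iso_fset (gT : finGroupType) (A : {set gT})
    (hT : groupType) (G : {fset hT}) : Prop :=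
  exists phi : gT -> hT,
    [/\ {in A &, {morph phi : s t / (s * t)%g >-> (s * t)%g}},
        {in A &, injective phi}
      & G =i [seq phi s | s in A]].

Definition rational_function_field (F L : fieldType) (iota : {rmorphism F -> L}) :=
  exists t : L, ~ algebraicOver iota t /\ forall u : L, in_adjoin iota t u.

(* L/F is regular: L is linearly disjoint over F from the algebraic closure of
   F.  Every field E containing L is considered, linear disjointness being
   tested against the elements of E algebraic over F; since E embeds into an
   algebraically closed field, it is equivalent to take E algebraically closed. *)
Definition regular_extension (F L : fieldType) (iota : {rmorphism F -> L}) : Prop :=
  forall (E : fieldType) (j : {rmorphism L -> E}) (n : nat) (u : 'I_n -> L),
    (forall c : 'I_n -> F,
        \sum_(i < n) iota (c i) * u i = 0 -> forall i, c i = 0) ->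
    forall a : 'I_n -> E,
      (forall i, algebraicOver (j \o iota) (a i)) ->
      \sum_(i < n) a i * j (u i) = 0 -> forall i, a i = 0.

Definition ratfun_emb (F : fieldType) (L : fieldExtType (ratfun F)) : F -> L :=
  in_alg L \o @ratfunC F.
HB.instance Definition _ (F : fieldType) (L : fieldExtType (ratfun F)) :=
  GRing.RMorphism.on (@ratfun_emb F L).

Definition is_splitting_field (K : fieldType) (h : {poly K})
    (L : splittingFieldType K) : Prop :=
  splittingFieldFor 1%VS (map_poly (in_alg L) h) {:L}%VS.

(* f(T) - z g(T), where z is the indeterminate of F(z). *)
Definition generic_poly (F : fieldType) (f g : {poly F}) : {poly ratfun F} :=
  map_poly (@ratfunC F) f - 'X%:F *: map_poly (@ratfunC F) g.

(* Main.v *)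
Require Import Defs.
From HB Require Import structures.
From mathcomp Require Import all_boot all_order all_algebra.
From mathcomp Require Import all_fingroup all_solvable all_field.
From mathcomp Require Import finmap generic_quotient ring.

Set Implicit Arguments.
Unset Strict Implicit.
Unset Printing Implicit Defensive.

Import GRing.Theory.
Local Open Scope ring_scope.


(**
Write x for the variable of the field on which PGL(2, F) acts, and h for
f(T) - z g(T).  Since Phi = f(x)/g(x) is transcendental over F, sending z to
Phi embeds F(z) in F(x) as F(x)^G, and everything is read off inside F(x),
where x is a root of h.

Irreducibility.  A polynomial over F(z) with root x is, after clearing
denominators, a polynomial W in z over F[x] vanishing at f(x)/g(x).  By the
rational root argument g divides its leading coefficient and f its lowest one;
so its degree in x is at least max(deg f, deg g), which is the degree of h
(generic_poly_minimal).  In a factorization of h one factor has root x, hence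
has full degree (generic_poly_irreducible).

The roots.  The orbit polynomial, the product of the T - s(x) for s in G, has
its coefficients in F(x)^G = F(Phi) because right translation permutes G.  It
has root x, so its degree |G| is at least deg h.  Conversely G fixes Phi, so
each of the |G| distinct s(x) is a root of h.  Hence h is a scalar multiple of
the orbit polynomial (generic_poly_orbit).  The same polynomial shows that Phi
is transcendental, since otherwise x would be algebraic over F
(generator_transc).

The splitting field.  In any extension L of F(z) containing a root t of h, t is
transcendental over F because z = f(t)/g(t), so x |-> t defines an embedding of
F(x) in L that carries Phi to z.  It transports the factorization of h, so its
roots in L are the s(t), all in F(z)(t) = F(t).  Thus L is a splitting field
exactly when L = F(z)(t); it is then rational, and Galois as the s(t) are
distinct.  Such an L exists, being F(z)[T]/(h).  An automorphism sends t to a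
unique s(t), and if it does so then it maps each r(t) to r(s(t)), so that
sending it to s is multiplicative (gal_mobius_iso).

Regularity.  Given a relation sum a_i u_i(t) = 0 with a_i algebraic over F,
common denominators make the u_i polynomials p_i.  The coefficients of
sum a_i p_i are algebraic over F and t is not, so this polynomial vanishes, and
linear independence over F of the p_i, being a rank condition on their
coefficients, persists over any larger field
(rational_function_field_regular).
*)

(** * Evaluation of rational functions at a transcendental element *)

Section Evaluation.
Variables (F E : fieldType) (iota : {rmorphism F -> E}) (t : E).

Lemma horner_transc_neq0 (p : {poly F}) :
  ~ algebraicOver iota t -> p != 0 -> (map_poly iota p).[t] != 0.
Proof. by move=> t_tr p0; apply/negP => /eqP/rootP pt; apply: t_tr; exists p. Qed.

(** The transcendence proof is an argument so that the function, which is total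
without it, can carry a ring morphism structure.  For E = F(x) its body is that
of [ratfun_comp], so the two are convertible and results on [ratfun_eval] apply
to the action of PGL(2, F). *)
Definition ratfun_eval of ~ algebraicOver iota t := fun r : ratfun F =>
  (map_poly iota \n_(repr r)).[t] / (map_poly iota \d_(repr r)).[t].

Hypothesis t_tr : ~ algebraicOver iota t.
Local Notation ev := (ratfun_eval t_tr).

Lemma ratfun_evalE (p q : {poly F}) :
  q != 0 -> ev (p%:F / q%:F) = (map_poly iota p).[t] / (map_poly iota q).[t].
Proof.
move=> q0; set r := p%:F / q%:F.
have d0 : \d_(repr r) != 0 by exact: denom_ratioP.
apply/eqP; rewrite /ratfun_eval eqr_div ?horner_transc_neq0 //.
rewrite -!hornerM -!rmorphM /=.
suff -> : \n_(repr r) * q = p * \d_(repr r) by [].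
apply/eqP; rewrite -tofrac_eq !tofracM -eqr_div ?tofrac_eq0 //.
by rewrite -ratfun_numden.
Qed.

Lemma ratfun_eval_tofrac p : ev p%:F = (map_poly iota p).[t].
Proof.
rewrite -[p%:F]divr1 -tofrac1 ratfun_evalE ?oner_eq0 //.
by rewrite rmorph1 hornerC divr1.
Qed.

Lemma ratfunP (r : ratfun F) : exists p q, q != 0 /\ r = p%:F / q%:F.
Proof.
exists \n_(repr r), \d_(repr r).
by split; [exact: denom_ratioP | exact: ratfun_numden].
Qed.

Fact ratfun_eval_is_zmod_morphism : zmod_morphism ev.
Proof.
move=> r s; have [p [q [q0 ->]]] := ratfunP r; have [u [v [v0 ->]]] := ratfunP s.
rewrite -mulNr -tofracN addf_div ?tofrac_eq0 // -!tofracM -tofracD.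
rewrite !ratfun_evalE ?mulf_neq0 // -mulNr addf_div ?horner_transc_neq0 //.
by rewrite !(rmorphD, rmorphM, rmorphN) /= !hornerE.
Qed.

Fact ratfun_eval_is_monoid_morphism : monoid_morphism ev.
Proof.
split=> [|r s]; first by rewrite -tofrac1 ratfun_eval_tofrac rmorph1 hornerC.
have [p [q [q0 ->]]] := ratfunP r; have [u [v [v0 ->]]] := ratfunP s.
rewrite mulf_div -!tofracM !ratfun_evalE ?mulf_neq0 // mulf_div.
by rewrite !rmorphM /= !hornerM.
Qed.

HB.instance Definition _ := GRing.isZmodMorphism.Build _ _ ev
  ratfun_eval_is_zmod_morphism.
HB.instance Definition _ := GRing.isMonoidMorphism.Build _ _ ev
  ratfun_eval_is_monoid_morphism.

Lemma ratfun_evalC c : ev (ratfunC c) = iota c.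
Proof. by rewrite ratfun_eval_tofrac map_polyC hornerC. Qed.

Lemma ratfun_evalX : ev 'X%:F = t.
Proof. by rewrite ratfun_eval_tofrac map_polyX hornerX. Qed.

Lemma in_adjoin_eval u : in_adjoin iota t u <-> exists r, u = ev r.
Proof.
split=> [[p [q [qt ->]]]|[r ->]].
  exists (p%:F / q%:F); rewrite ratfun_evalE //.
  by apply: contraNneq qt => ->; rewrite rmorph0 horner0.
have [p [q [q0 ->]]] := ratfunP r; exists p, q.
by rewrite ratfun_evalE ?horner_transc_neq0.
Qed.

End Evaluation.

Lemma rmorph_tofrac (F E : fieldType) (m : {rmorphism ratfun F -> E}) p :
  m p%:F = (map_poly (m \o @ratfunC F) p).[m 'X%:F].
Proof.
elim/poly_ind: p => [|p c IHp]; first by rewrite !rmorph0 horner0.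
by rewrite tofracD tofracM !(rmorphD, rmorphM) /= map_polyX map_polyC !hornerE IHp.
Qed.

(** This is how all the compatibilities between embeddings of F(x) and F(z) are
checked below: such a field is generated by the constants and the variable. *)
Lemma rmorph_ratfun_ext (F E : fieldType) (m1 m2 : {rmorphism ratfun F -> E}) :
  m1 \o @ratfunC F =1 m2 \o @ratfunC F -> m1 'X%:F = m2 'X%:F -> m1 =1 m2.
Proof.
move=> eqC eqX r; have [p [q [q0 ->]]] := ratfunP r.
rewrite !fmorph_div (rmorph_tofrac m1 p) (rmorph_tofrac m1 q).
by rewrite (rmorph_tofrac m2 p) (rmorph_tofrac m2 q) eqX !(eq_map_poly eqC).
Qed.

Section Transcendence.
Variable F : fieldType.

Lemma horner_ratfunX (p : {poly F}) : (map_poly (@ratfunC F) p).['X%:F] = p%:F.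
Proof. by rewrite [RHS](rmorph_tofrac idfun). Qed.

Lemma ratfunX_transc : ~ algebraicOver (@ratfunC F) 'X%:F.
Proof. by case=> p p0; rewrite /root horner_ratfunX tofrac_eq0 (negPf p0). Qed.

Lemma rmorph_algebraic (E E' : fieldType) (iota : {rmorphism F -> E})
    (m : {rmorphism E -> E'}) (u : E) :
  algebraicOver (m \o iota) (m u) <-> algebraicOver iota u.
Proof.
split=> -[p p0]; rewrite /root => up; exists p => //; last first.
  by rewrite /root map_poly_comp horner_map fmorph_eq0.
by move: up; rewrite map_poly_comp horner_map fmorph_eq0.
Qed.

End Transcendence.

(** * Irreducibility of the generic polynomial *)

Section Irreducibility.
Variables (F : fieldType) (f g : {poly F}).
Hypotheses (g_neq0 : g != 0) (cop_fg : coprimep f g).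

Let Phi : ratfun F := f%:F / g%:F.
Local Notation "p ^F" := (map_poly (@FracField.tofrac {poly F}) p).

Let gF_neq0 : g%:F != 0 :> ratfun F.
Proof. by rewrite tofrac_eq0. Qed.

(** Multiplying p(f/g) by g^m leaves f^i g^(m-i) in the i-th term, and g divides
every term except the one of degree m. *)
Lemma homogenized_eval m (p : {poly {poly F}}) : (size p <= m.+1)%N ->
  exists n, (p^F).[Phi] * (g ^+ m)%:F = (p`_m * f ^+ m + g * n)%:F.
Proof.
elim/poly_ind: p m => [|p c IHp] m.
  by move=> _; exists 0; rewrite rmorph0 horner0 coef0 !mul0r mulr0 addr0 tofrac0.
rewrite rmorphD rmorphM /= map_polyX map_polyC hornerD hornerM hornerX hornerC.
rewrite coefD coefMX coefC; have [-> | p0] := eqVneq p 0.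
  rewrite mul0r add0r rmorph0 horner0 mul0r add0r coef0 => szc.
  case: m szc => [|m] _.
    by exists 0; rewrite add0r !expr0 !mulr1 mulr0 addr0.
  by exists (c * g ^+ m); rewrite /= addr0 mul0r add0r mulrCA -exprS -tofracM.
rewrite -cons_poly_def size_cons_poly /nilp size_poly_eq0 (negPf p0) /=.
case: m => [|m]; first by rewrite ltnS leqn0 size_poly_eq0 (negPf p0).
move=> /IHp[n En]; exists (n * f + c * g ^+ m).
have EPhi : Phi * g%:F = f%:F by rewrite divfK.
transitivity ((p^F).[Phi] * (g ^+ m)%:F * f%:F + (c * g ^+ m.+1)%:F).
  rewrite exprSr !tofracM -[in RHS](divfK gF_neq0 f%:F) -/Phi; ring.
by rewrite En -tofracM -tofracD /= addr0 !exprS; congr (_%:F); ring.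
Qed.

Lemma root_dvd_lead_coef (W : {poly {poly F}}) :
  (W^F).[Phi] = 0 -> g %| lead_coef W.
Proof.
move=> W0; have [n] := homogenized_eval (leqSpred (size W)).
rewrite W0 mul0r => /esym/eqP; rewrite tofrac_eq0 addr_eq0 => /eqP Wf.
have cgf : coprimep g (f ^+ (size W).-1).
  by rewrite coprimep_expr // coprimep_sym.
by rewrite -(Gauss_dvdpl _ cgf) Wf dvdpNr dvdp_mulr.
Qed.

(** The other half of the rational root argument.  The coefficient in question
is the lowest nonzero one: the induction removes factors 'X until the constant
coefficient c is nonzero, and then f divides c g^(m+1). *)
Lemma root_dvd_low_coef (W : {poly {poly F}}) :
  f != 0 -> W != 0 -> (W^F).[Phi] = 0 -> exists2 i, W`_i != 0 & f %| W`_i.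
Proof.
move=> f0; elim/poly_ind: W => [|W c IHW]; first by rewrite eqxx.
have Phi0 : Phi != 0 by rewrite mulf_neq0 ?invr_eq0 ?tofrac_eq0.
rewrite rmorphD rmorphM /= map_polyX map_polyC hornerD hornerM hornerX hornerC.
have [-> | c0] := eqVneq c 0.
  rewrite rmorph0 !addr0 mulf_eq0 polyX_eq0 orbF => W0 /eqP.
  rewrite mulf_eq0 (negPf Phi0) orbF => /eqP/(IHW W0)[i Wi0 fWi].
  by exists i.+1; rewrite coefMX.
move=> _ Wc0; exists 0%N; rewrite coefD coefMX coefC add0r //=.
have [n En] := homogenized_eval (leqnSn (size W)).
have /eqP : (W^F).[Phi] * (g ^+ size W)%:F * f%:F + (c * g ^+ (size W).+1)%:F = 0.
  rewrite exprSr !tofracM -{1}(divfK gF_neq0 f%:F) -/Phi.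
  by rewrite mulrACA -mulrDl Wc0 mul0r.
rewrite En -tofracM -tofracD tofrac_eq0 addrC addr_eq0 => /eqP cg.
rewrite -(Gauss_dvdpl c (coprimep_expr (size W).+1 cop_fg)) cg.
by rewrite dvdpNr dvdp_mull.
Qed.

Lemma clear_denominators (q : {poly ratfun F}) :
  exists d Q, d != 0 /\ d%:F *: q = Q^F.
Proof.
elim/poly_ind: q => [|q c [d [Q [d0 Eq]]]].
  by exists 1, 0; rewrite oner_eq0 scaler0 rmorph0.
have [u [v [v0 ->]]] := ratfunP c.
exists (d * v), (v *: Q * 'X + (d * u)%:P); split; first by rewrite mulf_neq0.
rewrite [RHS]rmorphD [in RHS]rmorphM /= map_polyX map_polyC map_polyZ /= -Eq scalerDr.
rewrite scalerAl scalerA -tofracM [v * d]mulrC; congr (_ + _).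
by rewrite -mul_polyC -polyCM !tofracM [_ / _]mulrC mulrA mulfK ?tofrac_eq0.
Qed.

(** Coefficients of f and g cannot cancel each other, since 1 and z are linearly
independent over F. *)
Lemma size_generic_poly : size (generic_poly f g) = maxn (size f) (size g).
Proof.
have coefh i : (generic_poly f g)`_i = ((f`_i)%:P - 'X * (g`_i)%:P)%:F.
  by rewrite coefB coefZ !coef_map /= tofracB tofracM.
apply/eqP; rewrite eqn_leq geq_max; apply/and3P; split.
- apply/leq_sizeP => i; rewrite geq_max => /andP[fi gi].
  by rewrite coefh !nth_default // polyC0 mulr0 subrr tofrac0.
- apply/leq_sizeP => i /(nth_default 0)/eqP; rewrite coefh tofrac_eq0.
  by move=> /eqP/polyP/(_ 0%N); rewrite coefB coefC coefXM subr0 coef0.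
apply/leq_sizeP => i /(nth_default 0)/eqP; rewrite coefh tofrac_eq0.
move=> /eqP/polyP/(_ 1%N); rewrite coefB coefC coefXM coefC coef0 sub0r.
by move/eqP; rewrite oppr_eq0 => /eqP.
Qed.

Section Minimality.
Hypothesis Phi_tr : ~ algebraicOver (@ratfunC F) Phi.
Local Notation iota := (ratfun_eval Phi_tr).

(** A polynomial Q in z and T, evaluated at z = Phi and T = x, may be seen as a
polynomial in z with coefficients in F[x].  This is the form to which the
rational root argument applies. *)
Lemma horner_swap (Q : {poly {poly F}}) :
  (map_poly iota (Q^F)).['X%:F] = ((swapXY Q)^F).[Phi].
Proof.
pose U := map_poly (map_poly (@ratfunC F)) Q.
have -> : map_poly iota (Q^F) = map_poly (horner_eval Phi) U.
  rewrite -!map_poly_comp; apply: eq_map_poly => p /=.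
  by rewrite ratfun_eval_tofrac.
have -> : (swapXY Q)^F = map_poly (horner_eval 'X%:F) (swapXY U).
  rewrite /U swapXY_map -map_poly_comp; apply: eq_map_poly => p /=.
  by rewrite /horner_eval horner_ratfunX.
by rewrite -horner_swapXY -horner_polyC horner2_swapXY.
Qed.

(** The coefficients of W, the cleared form of q as a polynomial in z, are
polynomials in x of degree at most that of q; some nonzero one is divisible by
f, and some nonzero one by g. *)
Lemma generic_poly_minimal (q : {poly ratfun F}) :
  q != 0 -> root (map_poly iota q) 'X%:F -> (size (generic_poly f g) <= size q)%N.
Proof.
move=> q0 /rootP qx; have [d [Q [d0 Eq]]] := clear_denominators q.
have dF0 : d%:F != 0 :> ratfun F by rewrite tofrac_eq0.
have szQ : size q = size Q.
  rewrite -(size_scale q dF0) Eq size_map_inj_poly ?tofrac0 //.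
  by move=> u v /eqP; rewrite tofrac_eq => /eqP.
have Q0 : Q != 0 by rewrite -size_poly_eq0 -szQ size_poly_eq0.
have W0 : ((swapXY Q)^F).[Phi] = 0.
  by rewrite -horner_swap -Eq map_polyZ hornerZ qx mulr0.
have szW i : (size ((swapXY Q)`_i)%R <= size q)%N.
  by rewrite szQ -[in leqRHS](swapXYK Q) -sizeYE max_size_coefXY.
have f0 : f != 0.
  apply/eqP => f0; apply: Phi_tr; rewrite /Phi f0 tofrac0 mul0r.
  exact: algebraic0.
rewrite size_generic_poly geq_max; apply/andP; split.
  have [|i Wi0 fWi] := root_dvd_low_coef f0 _ W0; first by rewrite swapXY_eq0.
  exact: leq_trans (dvdp_leq Wi0 fWi) (szW i).
apply: leq_trans (dvdp_leq _ (root_dvd_lead_coef W0)) (szW _).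
by rewrite lead_coef_eq0 swapXY_eq0.
Qed.

Lemma root_generic_poly : root (map_poly iota (generic_poly f g)) 'X%:F.
Proof.
rewrite /root /generic_poly rmorphB /= map_polyZ /= ratfun_evalX.
have cE p : map_poly iota (map_poly (@ratfunC F) p) = map_poly (@ratfunC F) p.
  by rewrite -map_poly_comp; apply: eq_map_poly => c /=; rewrite ratfun_evalC.
by rewrite !cE hornerD hornerN hornerZ !horner_ratfunX divfK ?subrr.
Qed.

(** One of the two factors of the generic polynomial has root x, hence has its
full degree, and the other one is constant. *)
Lemma generic_poly_irreducible : irreducible_poly (generic_poly f g).
Proof.
have h0 : generic_poly f g != 0.
  by rewrite -size_poly_gt0 size_generic_poly leq_max orbC size_poly_gt0 g_neq0.
split=> [|q szq /dvdpP[r hE]].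
  rewrite -(size_map_poly iota); apply: root_size_gt1 root_generic_poly.
  by rewrite map_poly_eq0.
have /norP[r0 q0] : ~~ ((r == 0) || (q == 0)) by rewrite -mulf_eq0 -hE.
rewrite -dvdp_size_eqp; last by rewrite hE dvdp_mull.
have := root_generic_poly; rewrite hE rmorphM rootM => /orP[] /generic_poly_minimal.
  rewrite hE size_mul // => /(_ r0).
  have := size_poly_gt0 q; rewrite q0; case: (size q) szq => [|[|n]] //= _ _.
  by rewrite !addnS ltnNge leq_addr.
rewrite hE => /(_ q0) leq; rewrite eqn_leq leq andbT.
by rewrite dvdp_leq ?mulf_neq0 ?dvdp_mull.
Qed.
End Minimality.

End Irreducibility.

(** * Fractional linear substitutions *)

Section Mobius.
Variable F : fieldType.
Implicit Types A B : 'M[F]_2.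

Lemma sum_ord2 (V : nmodType) (e : 'I_2 -> V) :
  \sum_i e i = e ord0 + e ord_max.
Proof. by rewrite big_ord_recl big_ord1; congr (_ + e _); apply: val_inj. Qed.

Lemma det_mx2 A :
  \det A = A ord0 ord0 * A ord_max ord_max - A ord0 ord_max * A ord_max ord0.
Proof.
rewrite (expand_det_row _ ord0) sum_ord2 /cofactor !det_mx11 !mxE /=.
rewrite expr0 expr1 mul1r mulN1r mulrN.
by congr (_ * A _ _ - _ * A _ _); apply: val_inj.
Qed.

Lemma mobius_denom_neq0 A : A \in unitmx ->
  (A ord_max ord0)%:P * 'X + (A ord_max ord_max)%:P != 0 :> {poly F}.
Proof.
rewrite unitmxE unitfE det_mx2; apply: contraNneq => /polyP den0.
have := den0 0%N; have := den0 1%N.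
by rewrite !coefE /= mulr1 mulr0 addr0 add0r => -> ->; rewrite !mulr0 subrr.
Qed.

Lemma mobiusE A : mobius A =
  (ratfunC (A ord0 ord0) * 'X%:F + ratfunC (A ord0 ord_max)) /
  (ratfunC (A ord_max ord0) * 'X%:F + ratfunC (A ord_max ord_max)).
Proof. by rewrite /mobius !tofracD !tofracM. Qed.

Lemma linfrac_inv (K : fieldType) (a b c d x : K) :
    c * x + d != 0 -> a * d - b * c != 0 ->
  let u := (a * x + b) / (c * x + d) in x = (d * u - b) / (a - c * u).
Proof.
move=> D0 det0 /=; field; rewrite D0 /=.
by rewrite [X in X != 0](_ : _ = a * d - b * c) //; ring.
Qed.

Lemma linfrac_comp (K : fieldType) (a b c d a' b' c' d' x : K) :
    c' * x + d' != 0 ->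
  let u := (a' * x + b') / (c' * x + d') in
  (a * u + b) / (c * u + d) =
  ((a * a' + b * c') * x + (a * b' + b * d')) /
  ((c * a' + d * c') * x + (c * b' + d * d')).
Proof.
move=> D0 /=; set n := a' * x + b'; set D := c' * x + d'.
have clear_den e e' : (e * (n / D) + e') * D = e * n + e' * D.
  by rewrite mulrDl mulrA divfK.
rewrite -[LHS]mulr1 -(divff D0) mulf_div !clear_den /n /D.
by congr (_ / _); ring.
Qed.

Lemma horner_affine (K E : nzRingType) (m : {rmorphism K -> E}) (a b : K) (u : E) :
  (map_poly m (a%:P * 'X + b%:P)).[u] = m a * u + m b.
Proof. by rewrite rmorphD rmorphM /= map_polyX !map_polyC hornerMXaddC hornerC. Qed.

(** The variable is recovered from its image u by the inverse substitution, so u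
algebraic would make it algebraic. *)
Lemma mobius_transc A :
  A \in unitmx -> ~ algebraicOver (@ratfunC F) (mobius A).
Proof.
move=> uA; have := uA; rewrite unitmxE unitfE det_mx2.
rewrite -(fmorph_eq0 (@ratfunC F)) rmorphB !rmorphM /=.
have := mobius_denom_neq0 uA; rewrite -tofrac_eq0 tofracD tofracM.
rewrite mobiusE -!/(ratfunC _).
move: (A ord0 ord0) (A ord0 ord_max) (A ord_max ord0) (A ord_max ord_max).
move=> a b c d D0 det0.
set u := _ / _ => u_alg; apply: (@ratfunX_transc F).
have alg e : algebraicOver (@ratfunC F) (ratfunC e) by exact: algebraic_id.
have -> : 'X%:F = (ratfunC d * u - ratfunC b) / (ratfunC a - ratfunC c * u).
  exact: (linfrac_inv (D0 : ratfunC c * 'X%:F + ratfunC d != 0) det0).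
move: u u_alg => u u_alg; apply: algebraic_div; apply: algebraic_sub.
- exact: algebraic_mul (alg d) u_alg.
- exact: alg.
- exact: alg.
- exact: algebraic_mul (alg c) u_alg.
Qed.

Lemma mobius_mul A B : A \in unitmx -> B \in unitmx ->
  ratfun_comp (mobius A) (mobius B) = mobius (A *m B).
Proof.
move=> uA uB.
rewrite {1}/mobius ratfun_compE ?mobius_denom_neq0 //; last exact: mobius_transc.
rewrite !horner_affine !mobiusE !mxE !sum_ord2.
have D0 := mobius_denom_neq0 uB; rewrite -tofrac_eq0 tofracD tofracM in D0.
have splitC x y z w : ratfunC (x * y + z * w : F) =
  ratfunC x * ratfunC y + ratfunC z * ratfunC w by rewrite rmorphD !rmorphM.
rewrite !splitC; exact: (@linfrac_comp _ (ratfunC (A ord0 ord0))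
  (ratfunC (A ord0 ord_max)) (ratfunC (A ord_max ord0))
  (ratfunC (A ord_max ord_max)) _ _ _ _ _ D0).
Qed.

Lemma mobius_scalar A : A \in unitmx -> mobius A = 'X%:F -> is_scalar_mx A.
Proof.
move=> uA /eqP; rewrite /mobius -[X in _ == X]divr1 -tofrac1.
rewrite eqr_div ?tofrac_eq0 ?oner_eq0 ?mobius_denom_neq0 //.
rewrite -!tofracM tofrac_eq mulr1 => /eqP/polyP eqA.
apply/is_scalar_mxP; exists (A ord0 ord0); apply/matrixP=> i j.
have := eqA 0%N; have := eqA 1%N; have := eqA 2%N.
rewrite mulrDr !mulrA !coefE /=.
rewrite !mulr0 !mulr1 !mul0r !mul1r !addr0 !add0r mxE => c0 ad b0.
have ord2P k : (k == ord0 :> 'I_2) || (k == ord_max) by case: k => [[|[|]]].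
by case/orP: (ord2P i) => /eqP->; case/orP: (ord2P j) => /eqP->.
Qed.

End Mobius.

Section PGL2.
Variable F : fieldType.
Implicit Types s t : PGL2 F.

Lemma PGL2_mobius_transc s : ~ algebraicOver (@ratfunC F) (PGL2_mobius s).
Proof. exact/mobius_transc/(valP (repr s)). Qed.

Lemma PGL2_mobiusM s t : PGL2_act t (PGL2_mobius s) = PGL2_mobius (s * t)%g.
Proof.
rewrite /PGL2_act; elim/quotW: s => A; elim/quotW: t => B.
rewrite /mulg /= !piE !PGL2_mobius_pi; apply: mobius_mul; exact: valP.
Qed.

Lemma PGL2_mobius1 : PGL2_mobius (1%g : PGL2 F) = 'X%:F.
Proof.
rewrite /oneg /= piE PGL2_mobius_pi mobiusE !mxE /= rmorph0 rmorph1.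
by rewrite mul1r mul0r addr0 add0r divr1.
Qed.

(** By multiplicativity it is enough to treat the kernel, that is
[mobius_scalar]. *)
Lemma PGL2_mobius_inj : injective (@PGL2_mobius F).
Proof.
have mob1 s : PGL2_mobius s = 'X%:F -> s = 1%g.
  elim/quotW: s => A; rewrite PGL2_mobius_pi => /(mobius_scalar (valP A)) scA.
  by rewrite /oneg /= piE; apply/eqmodP; rewrite /= /pgl_eqv invmx1 mulmx1.
move=> s t eq_st; apply/divg1_eq/mob1.
by rewrite -PGL2_mobiusM eq_st PGL2_mobiusM mulgV PGL2_mobius1.
Qed.

End PGL2.

(** * The orbit polynomial *)

Section AlgebraicElements.
Variables (F E : fieldType) (iota : {rmorphism F -> E}).

Lemma algebraic_root (p : {poly E}) (u : E) : p != 0 -> root p u ->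
  (forall i, algebraicOver iota p`_i) -> algebraicOver iota u.
Proof.
move=> p0 pu alg_p; apply/integral_algebraic/(integral_root p0 pu).
by move=> _ /(nthP 0)[i _ <-]; apply/integral_algebraic.
Qed.

Lemma in_adjoin_algebraic (t u : E) :
  algebraicOver iota t -> in_adjoin iota t u -> algebraicOver iota u.
Proof.
move=> alg_t [p [q [_ ->]]].
have alg_ev (v : {poly F}) : algebraicOver iota (map_poly iota v).[t].
  apply/integral_algebraic/integral_horner; last exact/integral_algebraic.
  by apply/integral_poly => i; rewrite coef_map; apply: integral_id.
exact: algebraic_div.
Qed.

End AlgebraicElements.

Lemma map_poly_preim (K E : nzRingType) (m : {rmorphism K -> E}) (p : {poly E}) :
  (forall i, exists r, p`_i = m r) -> exists q, p = map_poly m q.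
Proof.
elim/poly_ind: p => [|p c IHp] pm; first by exists 0; rewrite rmorph0.
have [|q ->] := IHp.
  by move=> i; have [r] := pm i.+1; rewrite coefD coefMX coefC addr0; exists r.
have [r] := pm 0%N; rewrite coefD coefMX coefC add0r => ->.
by exists (q * 'X + r%:P); rewrite rmorphD rmorphM /= map_polyX map_polyC.
Qed.

Section OrbitPolynomial.
Variables (F : fieldType) (G : {fset PGL2 F}).

Definition orbit_poly : {poly ratfun F} :=
  \prod_(s <- G) ('X - (PGL2_mobius s)%:P).

Lemma size_orbit_poly : size orbit_poly = (size G).+1.
Proof. exact: size_prod_XsubC. Qed.

Lemma root_orbit_poly u :
  root orbit_poly u = (u \in [seq PGL2_mobius s | s <- G]).
Proof.
by rewrite /orbit_poly -(big_map _ xpredT (fun u => 'X - u%:P)) root_prod_XsubC.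
Qed.

Hypothesis hG : group_closed (mem G).

(** Acting by t replaces s(x) by (s t)(x), and right translation by t permutes
G. *)
Lemma orbit_poly_fixed i : fixed_ratfun G orbit_poly`_i.
Proof.
move=> t Gt; pose m : {rmorphism ratfun F -> ratfun F} :=
  ratfun_eval (@PGL2_mobius_transc F t).
suff mP : map_poly m orbit_poly = orbit_poly.
  by rewrite -[LHS]/(m _) -coef_map mP.
rewrite rmorph_prod /orbit_poly.
have permG : perm_eq [seq (s * t)%g | s <- G] G.
  have uG : uniq [seq (s * t)%g | s <- G].
    by rewrite map_inj_uniq ?fset_uniq //; apply: mulIg.
  apply: uniq_perm => //.
  have [||] := uniq_min_size uG (_ : {subset _ <= G}) => //.
  by move=> _ /mapP[s Gs ->]; apply: (group_closedM hG).
  by rewrite size_map.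
rewrite -[RHS](perm_big _ permG) big_map; apply: eq_bigr => s _.
by rewrite rmorphB /= map_polyX map_polyC /= [m _]PGL2_mobiusM.
Qed.

Lemma root_orbit_polyX : root orbit_poly 'X%:F.
Proof.
rewrite root_orbit_poly; apply/mapP; exists 1%g; first by case: hG.
by rewrite PGL2_mobius1.
Qed.

Variable Phi : ratfun F.
Hypothesis hPhi : generates_fixed_field G Phi.

(** If Phi were algebraic, so would be all of F(Phi), which contains the
coefficients of the orbit polynomial, and then also its root x. *)
Lemma generator_transc : ~ algebraicOver (@ratfunC F) Phi.
Proof.
move=> Phi_alg; apply: (@ratfunX_transc F).
apply: (algebraic_root _ root_orbit_polyX) => [|i].
  by rewrite -size_poly_gt0 size_orbit_poly.
by apply: in_adjoin_algebraic Phi_alg _; apply/hPhi/orbit_poly_fixed.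
Qed.

End OrbitPolynomial.

Section GenericPolynomial.
Variables (F : fieldType) (G : {fset PGL2 F}) (f g : {poly F}).
Hypotheses (hG : group_closed (mem G)) (g_neq0 : g != 0) (cop_fg : coprimep f g).
Let Phi : ratfun F := f%:F / g%:F.
Hypothesis hPhi : generates_fixed_field G Phi.
Hypothesis Phi_tr : ~ algebraicOver (@ratfunC F) Phi.
Local Notation iota := (ratfun_eval Phi_tr).

(** Acting by s on the root x of the generic polynomial, whose coefficients lie in
the fixed field, shows that s(x) is also a root; so the orbit polynomial divides
it.  The degrees agree, because the orbit polynomial comes from F(z) and has
root x, so that [generic_poly_minimal] applies to it. *)
Lemma generic_poly_orbit : map_poly iota (generic_poly f g) %= orbit_poly G.
Proof.
have h0 : generic_poly f g != 0.
  have [/ltnW] := generic_poly_irreducible g_neq0 cop_fg Phi_tr.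
  by rewrite size_poly_gt0.
have [q qE] : exists q, orbit_poly G = map_poly iota q.
  by apply: map_poly_preim => i; apply/in_adjoin_eval/hPhi/orbit_poly_fixed.
have Gh s : s \in G -> root (map_poly iota (generic_poly f g)) (PGL2_mobius s).
  move=> Gs; pose m : {rmorphism ratfun F -> ratfun F} :=
    ratfun_eval (@PGL2_mobius_transc F s).
  have mX : m 'X%:F = PGL2_mobius s by exact: ratfun_evalX.
  have mh : map_poly m (map_poly iota (generic_poly f g)) =
            map_poly iota (generic_poly f g).
    rewrite -map_poly_comp; apply: eq_map_poly.
    apply: rmorph_ratfun_ext => [c|].
      by rewrite /= ratfun_evalC; apply: ratfun_evalC.
    rewrite /= ratfun_evalX; apply: (proj2 (hPhi Phi)) => //.
    by apply/(in_adjoin_eval Phi_tr); exists 'X%:F; rewrite ratfun_evalX.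
  by rewrite -mX -mh /root horner_map fmorph_eq0 -/(root _ _) root_generic_poly.
have dvdP : orbit_poly G %| map_poly iota (generic_poly f g).
  rewrite /orbit_poly -(big_map _ xpredT (fun u => 'X - u%:P)).
  apply: uniq_roots_dvdp; last first.
    by rewrite uniq_rootsE map_inj_uniq ?fset_uniq //; apply: PGL2_mobius_inj.
  by apply/allP=> _ /mapP[s /Gh Gs ->].
rewrite eqp_sym -dvdp_size_eqp // eqn_leq dvdp_leq ?map_poly_eq0 //=.
rewrite qE !size_map_poly (generic_poly_minimal g_neq0 cop_fg (Phi_tr := Phi_tr)) //.
  by rewrite -(map_poly_eq0 iota) -qE -size_poly_gt0 size_orbit_poly.
by rewrite -qE root_orbit_polyX.
Qed.

End GenericPolynomial.

(** * Extensions of F(z) containing a root *)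

Section SplittingField.
Variables (F : fieldType) (G : {fset PGL2 F}) (f g : {poly F}).
Hypotheses (hG : group_closed (mem G)) (g_neq0 : g != 0) (cop_fg : coprimep f g).
Let Phi : ratfun F := f%:F / g%:F.
Hypothesis hPhi : generates_fixed_field G Phi.
Local Notation h := (generic_poly f g).
Variable L : fieldExtType (ratfun F).
Local Notation emb := (@ratfun_emb F L).
Variable t : L.
Hypothesis t_root : root (map_poly (in_alg L) h) t.

Let embE (p : {poly F}) :
  map_poly (in_alg L) (map_poly (@ratfunC F) p) = map_poly emb p.
Proof. by rewrite -map_poly_comp. Qed.

Lemma horner_generic_root :
  (map_poly emb f).[t] = in_alg L 'X%:F * (map_poly emb g).[t].
Proof.
move/rootP: t_root; rewrite rmorphB /= map_polyZ /= !embE.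
by rewrite hornerD hornerN hornerZ => /eqP; rewrite subr_eq0 => /eqP.
Qed.

(** Otherwise t would be a common root of the coprime polynomials f and g. *)
Lemma generic_root_denom_neq0 : (map_poly emb g).[t] != 0.
Proof.
apply/negP => /eqP gt0; have ft0 : root (map_poly emb f) t.
  by apply/rootP; rewrite horner_generic_root gt0 mulr0.
have cop : coprimep (map_poly emb f) (map_poly emb g) by rewrite coprimep_map.
by have := coprimep_root cop ft0; rewrite gt0 eqxx.
Qed.

(** z = f(t)/g(t) lies in F(t) and is transcendental over F. *)
Lemma generic_root_transc : ~ algebraicOver emb t.
Proof.
move=> t_alg; apply: (@ratfunX_transc F).
apply/(rmorph_algebraic _ (in_alg L))/(in_adjoin_algebraic t_alg).
exists f, g; split; first exact: generic_root_denom_neq0.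
by apply: (canRL (mulfK generic_root_denom_neq0)); rewrite -horner_generic_root.
Qed.

Local Notation psi := (ratfun_eval generic_root_transc).

Let Phi_tr : ~ algebraicOver (@ratfunC F) Phi := generator_transc hG hPhi.

(** The embedding x |-> t of F(x) in L is one over F(z), when F(x) is viewed as
an extension of F(z) through z |-> Phi. *)
Lemma eval_root_comp : psi \o ratfun_eval Phi_tr =1 in_alg L.
Proof.
apply: rmorph_ratfun_ext => [c|].
  by rewrite /= ratfun_evalC; apply: ratfun_evalC.
rewrite /= ratfun_evalX ratfun_evalE //.
apply: (canLR (mulfK generic_root_denom_neq0)); exact: horner_generic_root.
Qed.

Definition conjugate_root (s : PGL2 F) : L := psi (PGL2_mobius s).

Lemma conjugate_root_inj : injective conjugate_root.
Proof. by move=> s s' /fmorph_inj/PGL2_mobius_inj. Qed.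

Lemma generic_poly_split : map_poly (in_alg L) h %=
  \prod_(u <- [seq conjugate_root s | s <- G]) ('X - u%:P).
Proof.
rewrite -(eq_map_poly eval_root_comp) map_poly_comp big_map.
suff -> : \prod_(s <- G) ('X - (conjugate_root s)%:P) = map_poly psi (orbit_poly G).
  by rewrite eqp_map generic_poly_orbit.
rewrite rmorph_prod; apply: eq_bigr => s _.
by rewrite rmorphB /= map_polyX map_polyC.
Qed.

Lemma eval_root_mem_Fadjoin r : psi r \in <<1; t>>%VS.
Proof.
have polymem p : (map_poly emb p).[t] \in <<1; t>>%VS.
  by rewrite mempx_Fadjoin // -embE alg_polyOver.
have [p [q [q0 ->]]] := ratfunP r; rewrite ratfun_evalE //.
by apply: rpred_div; apply: polymem.
Qed.

(** An element of F(z)(t) is a polynomial in t over F(z), and F(z) is itself in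
the image of the embedding. *)
Lemma Fadjoin_eval_root u : u \in <<1; t>>%VS -> exists r, u = psi r.
Proof.
case/Fadjoin_polyP=> _ /polyOver1P[p ->] ->.
exists (map_poly (ratfun_eval Phi_tr) p).['X%:F].
transitivity (map_poly psi (map_poly (ratfun_eval Phi_tr) p)).[psi 'X%:F].
  by rewrite -map_poly_comp (eq_map_poly eval_root_comp) ratfun_evalX.
by rewrite horner_map.
Qed.

Lemma generic_root_splitting :
  <<1; t>>%VS = fullv -> splittingFieldFor 1 (map_poly (in_alg L) h) {:L}.
Proof.
move=> gen_t; exists [seq conjugate_root s | s <- G].
  exact: generic_poly_split.
apply/eqP; rewrite eqEsubv subvf -gen_t; apply/FadjoinP.
split; first exact: subv_adjoin_seq.
apply: seqv_sub_adjoin; rewrite -root_prod_XsubC -(eqp_root generic_poly_split).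
exact: t_root.
Qed.

Lemma splitting_generic_root :
  splittingFieldFor 1 (map_poly (in_alg L) h) {:L} -> <<1; t>>%VS = fullv.
Proof.
case=> rs h_rs gen_rs; apply/eqP; rewrite eqEsubv subvf -gen_rs.
apply/Fadjoin_seqP; split=> [|u]; first exact: subv_adjoin.
rewrite -root_prod_XsubC -(eqp_root h_rs) (eqp_root generic_poly_split).
by rewrite root_prod_XsubC => /mapP[s _ ->]; apply: eval_root_mem_Fadjoin.
Qed.

Hypothesis gen_t : <<1; t>>%VS = {:L}%VS.

Lemma splitting_rational : rational_function_field emb.
Proof.
exists t; split=> [|u]; first exact: generic_root_transc.
by apply/(in_adjoin_eval generic_root_transc)/Fadjoin_eval_root; rewrite gen_t memvf.
Qed.

(** The minimal polynomial has coefficients in F(z) and divides the generic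
polynomial, which is irreducible there. *)
Lemma generic_root_minPoly : minPoly 1 t %= map_poly (in_alg L) h.
Proof.
have [q qE] : exists q, minPoly 1 t = map_poly (in_alg L) q.
  exact/polyOver1P/minPolyOver.
have [_ irr_h] := generic_poly_irreducible g_neq0 cop_fg Phi_tr.
rewrite qE eqp_map irr_h //.
  by rewrite -(size_map_poly (in_alg L)) -qE size_minPoly.
by rewrite -(dvdp_map (in_alg L)) -qE minPoly_dvdp ?alg_polyOver.
Qed.

End SplittingField.

(** * The Galois group *)

Section GaloisGroup.
Variables (F : fieldType) (G : {fset PGL2 F}) (f g : {poly F}).
Hypotheses (hG : group_closed (mem G)) (g_neq0 : g != 0) (cop_fg : coprimep f g).
Let Phi : ratfun F := f%:F / g%:F.
Hypothesis hPhi : generates_fixed_field G Phi.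
Local Notation h := (generic_poly f g).
Variable L : splittingFieldType (ratfun F).
Local Notation emb := (@ratfun_emb F L).
Variable t : L.
Hypothesis t_root : root (map_poly (in_alg L) h) t.
Hypothesis gen_t : <<1; t>>%VS = {:L}%VS.

Local Notation psi := (ratfun_eval (generic_root_transc cop_fg t_root)).
Local Notation conj := (conjugate_root cop_fg t_root).
Local Notation Gal := ('Gal({:L} / 1))%g.

Lemma galois_splitting_field : galois 1 {:L}.
Proof.
apply/splitting_galoisField; exists (map_poly (in_alg L) h); split.
- exact: alg_polyOver.
- rewrite (eqp_separable (generic_poly_split hG g_neq0 cop_fg hPhi t_root)).
  rewrite separable_prod_XsubC map_inj_uniq ?fset_uniq //.
  exact: conjugate_root_inj.
have := generic_root_splitting hG g_neq0 cop_fg hPhi t_root gen_t.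
by [].
Qed.

Lemma gal_in_alg (s : gal_of {:L}) x : s (in_alg L x) = in_alg L x.
Proof. by rewrite /= linearZ rmorph1. Qed.

Lemma gal_conjugate (s : gal_of {:L}) : exists2 a, a \in G & s t = conj a.
Proof.
suff : root (map_poly (in_alg L) h) (s t).
  rewrite (eqp_root (generic_poly_split hG g_neq0 cop_fg hPhi t_root)).
  by rewrite root_prod_XsubC => /mapP[a Ga ->]; exists a.
have sh : map_poly s (map_poly (in_alg L) h) = map_poly (in_alg L) h.
  by rewrite -map_poly_comp; apply: eq_map_poly => x; apply: gal_in_alg.
by rewrite /root -sh horner_map (rootP t_root) rmorph0.
Qed.

(** An automorphism over F(z) is determined on F(t) by its value at t.  This is
what turns composition of automorphisms into substitution, in the order for
which [gal_mobius] is multiplicative: if s(t) = a(t) and s'(t) = a'(t), then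
(s s')(t) = s'(s(t)) = s'(a(t)) = a(a'(t)). *)
Lemma gal_eval_root (s : gal_of {:L}) a :
  s t = conj a -> forall r, s (psi r) = psi (PGL2_act a r).
Proof.
move=> st r; pose m : {rmorphism ratfun F -> ratfun F} :=
  ratfun_eval (@PGL2_mobius_transc F a).
suff E : s \o psi =1 psi \o m by exact: E.
apply: rmorph_ratfun_ext => [c|].
  by rewrite /= !ratfun_evalC; apply: gal_in_alg.
by rewrite /= !ratfun_evalX; apply: st.
Qed.

Lemma gal_transitive a : a \in G -> exists2 s, s \in Gal & s t = conj a.
Proof.
move=> Ga; apply: normalField_root_minPoly (sub1v _) _ (memvf t) _.
  by case/and3P: galois_splitting_field.
rewrite (eqp_root (generic_root_minPoly hG g_neq0 cop_fg hPhi t_root)).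
rewrite (eqp_root (generic_poly_split hG g_neq0 cop_fg hPhi t_root)).
by rewrite root_prod_XsubC map_f.
Qed.

(** The element a of G with s(t) = a(t); the default value 1 is never taken, by
[gal_conjugate]. *)
Definition gal_mobius (s : gal_of {:L}) : PGL2 F :=
  nth 1%g G (index (s t) [seq conj a | a <- G]).

Lemma gal_mobiusP s : gal_mobius s \in G /\ s t = conj (gal_mobius s).
Proof.
have [a Ga st] := gal_conjugate s; rewrite /gal_mobius st index_map ?nth_index //.
exact: conjugate_root_inj.
Qed.

Lemma gal_mobius_iso : group_iso_fset Gal G.
Proof.
have conj_inj := @conjugate_root_inj _ _ _ cop_fg L t t_root.
exists gal_mobius; split=> [s s' _ _|s s' _ _|a].
- have [_ st] := gal_mobiusP s; have [_ st'] := gal_mobiusP s'.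
  have [_ sst] := gal_mobiusP (s * s')%g.
  apply: conj_inj; rewrite -sst galM ?memvf // st (gal_eval_root st').
  by rewrite PGL2_mobiusM.
- have [_ st] := gal_mobiusP s; have [_ st'] := gal_mobiusP s' => eq_ss'.
  apply/eqP/gal_eqP => u _; have : u \in <<1; t>>%VS by rewrite gen_t memvf.
  case/(Fadjoin_eval_root hG g_neq0 cop_fg hPhi t_root) => r ->.
  by rewrite (gal_eval_root st) (gal_eval_root st') eq_ss'.
apply/idP/imageP => [/gal_transitive[s Gs st]|[s _ ->]].
  by exists s => //; apply: conj_inj; rewrite -st; case: (gal_mobiusP s).
by case: (gal_mobiusP s).
Qed.

End GaloisGroup.

(** * Regularity of rational function fields *)

Lemma common_denominator (F L : fieldType) (iota : {rmorphism F -> L}) (t : L)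
    n (u : 'I_n -> L) :
    (forall i, in_adjoin iota t (u i)) ->
  exists d (p : 'I_n -> {poly F}), d != 0 /\
    forall i, u i * (map_poly iota d).[t] = (map_poly iota (p i)).[t].
Proof.
move=> u_t; have /fin_all_exists[r rE] i : exists pq : {poly F} * {poly F},
    pq.2 != 0 /\ u i * (map_poly iota pq.2).[t] = (map_poly iota pq.1).[t].
  have [p [q [q0 ->]]] := u_t i; exists (p, q); split; last by rewrite divfK.
  by apply: contraNneq q0 => /= ->; rewrite rmorph0 horner0.
exists (\prod_i (r i).2), (fun i => (r i).1 * \prod_(j | j != i) (r j).2).
split=> [|i]; first by apply/prodf_neq0 => i _; case: (rE i).
by rewrite (bigD1 i) //= !rmorphM !hornerM mulrA (proj2 (rE i)).
Qed.

(** Independence of the p_i over F says that the matrix of their coefficients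
has full row rank, and the rank does not change when the field is enlarged. *)
Lemma linear_free_algebraic (F E : fieldType) (iota : {rmorphism F -> E}) n
    (p : 'I_n -> {poly F}) (a : 'I_n -> E) :
    (forall c : 'I_n -> F, \sum_i c i *: p i = 0 -> forall i, c i = 0) ->
  \sum_i a i *: map_poly iota (p i) = 0 -> forall i, a i = 0.
Proof.
move=> p_free ap0; pose N := \max_i size (p i).
pose M : 'M[F]_(n, N) := \matrix_(i, j) (p i)`_j.
have freeM : row_free M.
  apply: inj_row_free => v vM0; apply/rowP => i; rewrite mxE.
  apply: p_free i; apply/polyP => k; rewrite coef0 coef_sum.
  have [kN|Nk] := ltnP k N; last first.
    apply: big1 => i _; rewrite coefZ nth_default ?mulr0 //.
    exact: leq_trans (leq_bigmax i) Nk.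
  transitivity ((v *m M) 0 (Ordinal kN)); last by rewrite vM0 mxE.
  by rewrite mxE; apply: eq_bigr => i _; rewrite coefZ mxE.
have freeME : row_free (map_mx iota M) by rewrite row_free_map.
have /(row_free_inj freeME) : (\row_i a i) *m map_mx iota M = 0 *m map_mx iota M.
  rewrite mul0mx; apply/rowP => k; rewrite !mxE.
  transitivity (\sum_i a i *: map_poly iota (p i))`_k; last by rewrite ap0 coef0.
  by rewrite coef_sum; apply: eq_bigr => i _; rewrite !mxE coefZ coef_map.
by move=> a0 i; move/rowP/(_ i): a0; rewrite !mxE.
Qed.

(** After multiplication by a common denominator, the relation says that the
image of t is a root of a polynomial with coefficients algebraic over F.  As
t is transcendental, this polynomial is zero, and [linear_free_algebraic]
applies. *)
Lemma rational_function_field_regular (F L : fieldType) (iota : {rmorphism F -> L}) :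
  rational_function_field iota -> regular_extension iota.
Proof.
case=> t [t_tr gen_t] E j n u u_free a a_alg au0.
have [d [p [d0 upE]]] := common_denominator (fun i => gen_t (u i)).
have dt0 := horner_transc_neq0 t_tr d0.
have p_free c : \sum_i c i *: p i = 0 -> forall i, c i = 0.
  move=> cp0; apply: u_free; apply: (mulIf dt0); rewrite mul0r mulr_suml.
  transitivity (map_poly iota (\sum_i c i *: p i)).[t].
    rewrite rmorph_sum horner_sum; apply: eq_bigr => i _.
    by rewrite /= map_polyZ hornerZ -upE mulrA.
  by rewrite cp0 rmorph0 horner0.
apply: (linear_free_algebraic p_free (iota := j \o iota)).
apply/eqP/negP => /negP P0; apply: t_tr.
apply/(rmorph_algebraic _ j)/(algebraic_root P0).
  rewrite /root horner_sum.
  transitivity ((\sum_i a i * j (u i)) * j (map_poly iota d).[t] == 0).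
    congr (_ == _); rewrite mulr_suml; apply: eq_bigr => i _.
    by rewrite hornerZ map_poly_comp horner_map -upE rmorphM mulrA.
  by rewrite au0 mul0r eqxx.
move=> k; rewrite coef_sum; apply: big_ind => [||i _].
- exact: algebraic0.
- by move=> x y; apply: algebraic_add.
rewrite coefZ coef_map; apply: algebraic_mul => //; exact: algebraic_id.
Qed.

(** * Galois theory of the generic polynomial *)

Theorem theorem4 (F : fieldType) (G : {fset PGL2 F}) (hG : group_closed (mem G))
    (Phi : ratfun F) (hPhi : generates_fixed_field G Phi)
    (f g : {poly F}) (g_neq0 : g != 0) (cop_fg : coprimep f g)
    (Phi_fg : Phi = f%:F / g%:F) :
  [/\ irreducible_poly (generic_poly f g),
      exists L : splittingFieldType (ratfun F),
        is_splitting_field (generic_poly f g) L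
    & forall L : splittingFieldType (ratfun F),
        is_splitting_field (generic_poly f g) L ->
        [/\ galois 1%VS {:L}%VS,
            group_iso_fset ('Gal({:L} / 1))%g G,
            rational_function_field (@ratfun_emb F L)
          & regular_extension (@ratfun_emb F L)]].
Proof.
subst Phi; have h_irr : irreducible_poly (generic_poly f g).
  exact: generic_poly_irreducible g_neq0 cop_fg (generator_transc hG hPhi).
split=> // [|L splitL].
  have [L _ [t t_root gen_t]] := irredp_FAdjoin h_irr.
  have splitL := generic_root_splitting hG g_neq0 cop_fg hPhi t_root gen_t.
  have axL : splitting_field_axiom L.
    by exists (map_poly (in_alg L) (generic_poly f g)); first exact: alg_polyOver.
  (* The carrier is F(z)[T]/(h), where h is the generic polynomial: one root
     already generates a splitting field. *)
  pose sL : splittingFieldType (ratfun F) :=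
    HB.pack L (FieldExt_isSplittingField.Build (ratfun F) L axL).
  by exists sL.
have [t t_root] : exists t, root (map_poly (in_alg L) (generic_poly f g)) t.
  have [rs h_rs _] := splitL; case: rs h_rs => [|t rs] h_rs.
    have := eqp_size h_rs; rewrite size_map_poly big_nil size_poly1 => szh.
    by case: h_irr; rewrite szh.
  by exists t; rewrite (eqp_root h_rs) root_prod_XsubC mem_head.
have gen_t := splitting_generic_root hG g_neq0 cop_fg hPhi t_root splitL.
have ratL := splitting_rational hG g_neq0 cop_fg hPhi t_root gen_t.
have galL := galois_splitting_field hG g_neq0 cop_fg hPhi t_root gen_t.
have isoL := gal_mobius_iso hG g_neq0 cop_fg hPhi t_root gen_t.
by split; [exact galL | exact isoL | exact ratL | exact: rational_function_field_regular].
Qed.
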